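(* Let $J\subset\mathbb R$ be a closed interval, $\{n_k\}_{k\ge1}$ a sequence of integers with $n_k\ge 2$ for all $k$, and $\{c_k\}_{k\ge 1}$ a sequence with $c_k\in(0,1/n_k]$ for all $k$. If $$\lim_{k\to\infty}\frac{\log c_k}{\log(c_1\cdots c_k)}=0\quad\text{and}\quad \limsup_{k\to\infty}\frac{\log n_k}{-\log c_k}<1,$$ then any Moran set $E\in\mathcal M(J,\{n_k\},\{c_k\})$ is quasi uniformly disconnected.
   Context: Moran sets: let $J\subset\mathbb R$ be a (bounded, nondegenerate) closed interval, $n_k\ge2$ integers and $c_k\in(0,1/n_k]$ for $k\ge1$. Let $\mathcal D^k=\{i_1\cdots i_k: i_t\in\mathbb N\cap[1,n_t]\text{ for all }t\}$ and $\mathcal D^0=\{\emptyset\}$ (empty word), $J_\emptyset=J$. Suppose that for every $k\ge1$ and every $i_1\cdots i_{k-1}\in\mathcal D^{k-1}$, $J_{i_1\cdots i_{k-1}1},\dots,J_{i_1\cdots i_{k-1}n_k}$ are closed subintervals of $J_{i_1\cdots i_{k-1}}$ with pairwise disjoint interiors such that $|J_{i_1\cdots i_{k-1}j}|/|J_{i_1\cdots i_{k-1}}|=c_k$ for all $1\le j\le n_k$ (where $|\cdot|$ is length). Their relative positions are otherwise arbitrary (and may vary with the word; adjacent ones may share an endpoint). The compact set $F=\bigcap_{k=0}^\infty\bigcup_{i_1\cdots i_k\in\mathcal D^k}J_{i_1\cdots i_k}$ is called a Moran set with structure $(J,\{n_k\},\{c_k\})$, and $\mathcal M(J,\{n_k\},\{c_k\})$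 denotes the class of all such sets. Quasi uniformly disconnected: a compact subset $E$ of a metric space is quasi uniformly disconnected if there are a function $\psi:\mathbb R^+\to\mathbb R^+$ with $\psi(r)<r$ for all $r>0$ and $\lim_{r\to 0}\frac{\log\psi(r)}{\log r}=1$, and a constant $r^*>0$, such that for every $x\in E$ and every $0<r<r^*$ there is a set $E_{x,r}\subset E$ with $$E\cap B(x,\psi(r))\subset E_{x,r}\subset B(x,r)\quad\text{and}\quad \mathrm{dist}(E_{x,r},E\setminus E_{x,r})\ge\psi(r),$$ where $B(x,r)$ is the closed ball with center $x$ and radius $r$ and $\mathrm{dist}(A,B)=\inf\{\mathrm d(a,b):a\in A,b\in B\}$ (equal to $+\infty$ if $A$ or $B$ is empty). Here $E\subset\mathbb R$ with the Euclidean metric. *)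

(* Defs.v *)
From mathcomp Require Import all_boot all_order all_algebra.
From mathcomp Require Import all_classical all_reals all_analysis.

Set Implicit Arguments.
Unset Strict Implicit.
Unset Printing Implicit Defensive.

Import Order.TTheory GRing.Theory Num.Theory.
Import numFieldNormedType.Exports.

Local Open Scope classical_set_scope.
Local Open Scope ring_scope.

Section MoranSets.
Context {R : realType}.

(* A closed interval is given by its pair of endpoints, so that its length is
   the difference of the endpoints. *)
Definition itv_set (I : R * R) : set R := [set` `[I.1, I.2]].

Definition itv_length (I : R * R) : R := I.2 - I.1.

(* The sequences (n_k) and (c_k) are indexed by k >= 1 as in the usual
   definition; their values at 0 are never used. A word is a sequence of natural
   numbers; its letter in position t (counted from 1) is [nth 0 w t.-1]. *)
Definition word (n : nat -> nat) (k : nat) : set (seq nat) :=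
  [set w | size w = k /\
     forall t, (1 <= t <= k)%N -> (1 <= nth 0%N w t.-1 <= n t)%N].

(* The values of [I] on sequences which are not words are irrelevant. When J is
   nondegenerate and every c_k is positive, the ratio condition forces all the
   basic intervals to be nondegenerate. *)
Definition moran_structure (J : R * R) (n : nat -> nat) (c : nat -> R)
    (I : seq nat -> R * R) : Prop :=
  I [::] = J /\
  forall (k : nat) (w : seq nat), (1 <= k)%N -> word n k.-1 w ->
    [/\ forall j, (1 <= j <= n k)%N ->
          itv_set (I (rcons w j)) `<=` itv_set (I w),
        trivIset [set j | (1 <= j <= n k)%N]
          (fun j => (itv_set (I (rcons w j)))°)
      & forall j, (1 <= j <= n k)%N ->
          itv_length (I (rcons w j)) / itv_length (I w) = c k].

Definition moran_limit_set (n : nat -> nat) (I : seq nat -> R * R) : set R :=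
  \bigcap_k \bigcup_(w in word n k) itv_set (I w).

Definition moran_class (J : R * R) (n : nat -> nat) (c : nat -> R) :
    set (set R) :=
  [set F | exists I, moran_structure J n c I /\ F = moran_limit_set n I].

End MoranSets.

Section QuasiUniformlyDisconnected.
Context {R : realType} {T : metricType R}.

(* The library's [closed_ball] is the closure of the open ball, which in a
   general metric space may be smaller than this set. *)
Definition cball (x : T) (r : R) : set T := [set y | mdist x y <= r].

Definition set_dist (A B : set T) : \bar R :=
  ereal_inf [set (mdist a b)%:E | a in A & b in B].

Definition quasi_uniformly_disconnected (E : set T) : Prop :=
  compact E /\
  exists (psi : R -> R) (rstar : R),
    [/\ forall r, 0 < r -> 0 < psi r < r,
        (fun r => ln (psi r) / ln r) @ 0^'+ --> (1 : R),
        0 < rstar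
      & forall (x : T) (r : R), E x -> 0 < r < rstar ->
          exists Exr : set T,
            [/\ Exr `<=` E,
                E `&` cball x (psi r) `<=` Exr,
                Exr `<=` cball x r
              & ((psi r)%:E <= set_dist Exr (E `\` Exr))%E]].

End QuasiUniformlyDisconnected.

(* The library's metric space structure on the real line is carried by the
   alias [R^o] of [R]; its metric is the Euclidean one. *)
Lemma mdist_real (R : realType) (x y : R^o) : mdist x y = `|x - y|.
Proof. exact: distrC. Qed.

(* Main.v *)
(* Let L_k = |J| c_1 ... c_k be the length of the basic intervals of rank k. The
   limsup hypothesis gives theta < 1 with n_k c_k <= theta for large k. Put
   psi(r) = L_(k(r)+q), where k(r) is the least k with L_k <= r. At most a
   constant times r / L_k basic intervals of rank k = k(r) meet a window of length
   r / 2, and their descendants of rank k + q have total length at most a constant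
   times theta^q r. For q fixed and large enough these cannot come within psi(r)
   of all points of the window, so each of [x - r, x - r/2] and [x + r/2, x + r]
   contains a point at distance greater than psi(r) from E, and E_(x,r) is the
   part of E between the two points. The limit hypothesis says that
   log L_k / log L_(k+1) -> 1, and for fixed q this gives
   log psi(r) / log r -> 1. *)
Require Import Defs.
From mathcomp Require Import all_boot all_order all_algebra.
From mathcomp Require Import all_classical all_reals all_analysis.
From mathcomp Require Import lra.

Import Order.TTheory GRing.Theory Num.Theory.
Import numFieldNormedType.Exports.

Local Open Scope classical_set_scope.
Local Open Scope ring_scope.

(** * Words, prefixes and the number of extensions *)

Section Words.
Context (n : nat -> nat).

Lemma word0 (w : seq nat) : word n 0 w -> w = [::].
Proof. by case=> /size0nil. Qed.

Lemma word_rcons (k : nat) (w : seq nat) : word n k.+1 w ->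
  exists u j, [/\ w = rcons u j, word n k u & (1 <= j <= n k.+1)%N].
Proof.
case: (lastP w) => [[] //|u j] [].
rewrite size_rcons => -[su] wP; exists u, j; split => //.
- split=> // t /andP[t0 tk].
  have := wP t; rewrite t0 (leq_trans tk) // => /(_ isT).
  by rewrite nth_rcons su; case: t t0 tk => //= t _ ->.
- by have := wP k.+1; rewrite /= leqnn => /(_ isT); rewrite nth_rcons su ltnn eqxx.
Qed.

Lemma word_take (k m : nat) (w : seq nat) :
  (k <= m)%N -> word n m w -> word n k (take k w).
Proof.
move=> km [sw wP]; split; first by rewrite size_takel // sw.
move=> t /andP[t0 tk]; rewrite nth_take; last by case: t t0 tk.
by apply: wP; rewrite t0 (leq_trans tk).
Qed.

Lemma take_rcons_size (k : nat) (u : seq nat) (j : nat) :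
  word n k u -> take k (rcons u j) = u.
Proof. by case=> su _; rewrite -cats1 -su take_size_cat. Qed.

Lemma finite_word (k : nat) : finite_set (word n k).
Proof.
elim: k => [|k IHk].
  by apply: (sub_finite_set _ (finite_set1 [::])) => w /word0 ->.
have := finite_image2 (@rcons nat) IHk (finite_II (n k.+1).+1).
apply: sub_finite_set => w /word_rcons[u [j [-> uP /andP[_ jn]]]].
by exists u => //; exists j.
Qed.

(** Induction on [q]: deleting the last letter sends [s] to words of rank [k + q], and each of these
    has at most [n (k + q).+1] one-letter extensions. Taking [P] to be the rank [k] prefixes bounds
    the number of long words by the number of their ancestors. *)
Lemma size_words_le (k q : nat) (s P : seq (seq nat)) :
  uniq s -> {in s, forall w, word n (k + q) w} ->
  {in s, forall w, take k w \in P} ->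
  (size s <= size P * \prod_(k.+1 <= i < (k + q).+1) n i)%N.
Proof.
elim: q s => [|q IHq] s us sP stP.
  rewrite addn0 big_geq // muln1; apply: uniq_leq_size => // w ws.
  have := stP w ws; rewrite take_oversize //.
  by have [-> _] := sP w ws; rewrite addn0.
pose s' := undup [seq take (k + q) w | w <- s].
have s'P : (size s' <= size P * \prod_(k.+1 <= i < (k + q).+1) n i)%N.
  apply: IHq; first exact: undup_uniq.
    move=> w; rewrite mem_undup => /mapP[v vs ->].
    by apply: (@word_take _ (k + q.+1)); [rewrite leq_add2l | exact: sP].
  move=> w; rewrite mem_undup => /mapP[v vs ->].
  by rewrite take_takel ?leq_addr //; exact: stP.
rewrite addnS big_nat_recr /=; last by rewrite ltnS leq_addr.
rewrite mulnA; apply: leq_trans (leq_mul s'P (leqnn _)).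
rewrite -[X in (_ * X)%N](size_iota 1) -(size_allpairs (@rcons nat)).
apply: uniq_leq_size => // w ws.
have := sP w ws; rewrite addnS => /word_rcons[u [j [wE uP jP]]].
apply/allpairsP; exists (u, j); split => //=.
  by rewrite mem_undup; apply/mapP; exists w; rewrite // wE take_rcons_size.
by rewrite mem_iota add1n ltnS.
Qed.

End Words.

(** * Separated points in a bounded interval *)

Section Counting.
Context {R : realType}.

(** Cut the interval into half-open cells of length [d] starting at [a]. Two values in one cell
    would be less than [d] apart, so the cell number [g] is injective on [s]; it is at most the
    integer part of [B / d]. *)
Lemma size_separated_le (T : eqType) (f : T -> R) (s : seq T) (a B d : R) :
  0 < d -> 0 <= B -> uniq s ->
  {in s &, forall u v, u != v -> d <= `|f u - f v|} ->
  {in s, forall u, a <= f u <= a + B} -> (size s)%:R <= B / d + 1.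
Proof.
move=> d0 B0 us sep fB.
pose g u := Num.trunc ((f u - a) / d).
have g0 u : u \in s -> 0 <= (f u - a) / d.
  by move=> /fB /andP[? _]; apply: divr_ge0; lra.
have ug : uniq (map g s).
  rewrite map_inj_in_uniq // => u v us' vs guv; apply/eqP/negPn/negP => uv.
  have := sep u v us' vs uv.
  have /andP[u1 u2] := truncn_itv (g0 u us').
  have /andP[v1 v2] := truncn_itv (g0 v vs).
  rewrite -/(g u) guv in u1 u2; rewrite -/(g v) in v1 v2.
  rewrite ler_pdivlMr // in u1; rewrite ler_pdivlMr // in v1.
  rewrite ltr_pdivrMr // in u2; rewrite ltr_pdivrMr // in v2.
  move: u1 u2 v1 v2; rewrite -natr1 mulrDl mul1r => u1 u2 v1 v2.
  apply/negP; rewrite -ltNge ltr_norml; apply/andP; split; lra.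
have : (size (map g s) <= (Num.trunc (B / d)).+1)%N.
  rewrite -(size_iota 0 (Num.trunc (B / d)).+1).
  apply: uniq_leq_size => // _ /mapP[u us' ->].
  rewrite mem_iota /= add0n ltnS; apply: le_truncn.
  have /andP[_ ?] := fB u us'.
  by rewrite ler_pM2r ?invr_gt0 //; lra.
rewrite size_map -(ler_nat R) -natr1 => /le_trans; apply.
by rewrite lerD2r; have /andP[] := truncn_itv (divr_ge0 B0 (ltW d0)).
Qed.

End Counting.

(** * Lengths and positions of the basic intervals *)

Section Moran.
Context {R : realType} (J : R * R) (n : nat -> nat) (c : nat -> R)
  (I : seq nat -> R * R).
Hypothesis hJ : J.1 < J.2.
Hypothesis hn : forall k, (1 <= k)%N -> (2 <= n k)%N.
Hypothesis hc : forall k, (1 <= k)%N -> 0 < c k <= 1 / (n k)%:R.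
Hypothesis hI : moran_structure J n c I.

Definition rank_length (k : nat) : R :=
  (J.2 - J.1) * \prod_(1 <= i < k.+1) c i.

Local Notation L := rank_length.

Lemma c_gt0 k : (1 <= k)%N -> 0 < c k.
Proof. by move=> /hc /andP[]. Qed.

Lemma c_le_half k : (1 <= k)%N -> c k <= 2^-1.
Proof.
move=> k1; have /andP[_ /le_trans] := hc k k1; apply.
rewrite div1r lef_pV2 ?posrE //; first by rewrite ler_nat hn.
by rewrite ltr0n (leq_trans _ (hn k k1)).
Qed.

Lemma rank_lengthS k : L k.+1 = L k * c k.+1.
Proof. by rewrite /L big_nat_recr //= mulrA. Qed.

Lemma rank_lengthD k q :
  L (k + q)%N = L k * \prod_(k.+1 <= i < (k + q).+1) c i.
Proof.
by rewrite /L -mulrA -big_cat_nat // ltnS leq_addr.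
Qed.

Lemma rank_length_gt0 k : 0 < L k.
Proof.
elim: k => [|k IHk]; first by rewrite /L big_geq // mulr1 subr_gt0.
by rewrite rank_lengthS mulr_gt0 // c_gt0.
Qed.

Lemma rank_lengthS_le k : L k.+1 <= L k / 2.
Proof. by rewrite rank_lengthS ler_pM2l ?rank_length_gt0 // c_le_half. Qed.

Lemma rank_length_le k m : (k <= m)%N -> L m <= L k.
Proof.
elim: m => [|m IHm]; first by rewrite leqn0 => /eqP ->.
rewrite leq_eqVlt => /predU1P[-> //|]; rewrite ltnS => /IHm h.
by have := rank_lengthS_le m; have := rank_length_gt0 m; lra.
Qed.

Lemma itv_length_word k w : word n k w -> itv_length (I w) = L k.
Proof.
elim: k w => [|k IHk] w.
  by move=> /word0 ->; rewrite hI.1 /L big_geq // mulr1.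
move=> /word_rcons[u [j [-> uP jP]]].
have [_ _ /(_ j jP)] := hI.2 k.+1 u isT uP.
rewrite (IHk u uP) rank_lengthS => <-.
by rewrite mulrC divfK // gt_eqF // rank_length_gt0.
Qed.

Lemma itv_set_sub_endpoints (A B : R * R) : A.1 <= A.2 ->
  itv_set A `<=` itv_set B -> B.1 <= A.1 /\ A.2 <= B.2.
Proof.
move=> A12 AB; have := AB A.1; have := AB A.2.
rewrite /itv_set /= !in_itv /= !lexx A12 => /(_ isT) /andP[_ ?] /(_ isT) /andP[? _].
by [].
Qed.

Lemma word_endpoints k w : word n k w -> (I w).2 = (I w).1 + L k.
Proof. by move=> /itv_length_word <-; rewrite /itv_length addrC subrK. Qed.

Lemma rcons_endpoints k u j : word n k u -> (1 <= j <= n k.+1)%N ->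
  [/\ (I u).1 <= (I (rcons u j)).1, (I (rcons u j)).2 <= (I u).2
    & (I (rcons u j)).2 = (I (rcons u j)).1 + L k.+1].
Proof.
move=> uP jP; have [/(_ j jP) sub _ /(_ j jP)] := hI.2 k.+1 u isT uP.
rewrite (itv_length_word _ _ uP) => /(canRL (divfK _)).
rewrite gt_eqF ?rank_length_gt0 // => /(_ isT).
rewrite mulrC -rank_lengthS /itv_length => len.
have E : (I (rcons u j)).2 = (I (rcons u j)).1 + L k.+1 by rewrite -len addrC subrK.
have [] := @itv_set_sub_endpoints (I (rcons u j)) (I u) _ sub; last by split.
by rewrite E lerDl ltW // rank_length_gt0.
Qed.

Lemma take_endpoints k q w : word n (k + q) w ->
  (I (take k w)).1 <= (I w).1 /\ (I w).2 <= (I (take k w)).2.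
Proof.
elim: q w => [|q IHq] w; rewrite ?addnS.
  by move=> [sw _]; rewrite take_oversize // sw addn0.
move=> /word_rcons[u [j [-> uP jP]]].
have [h1 h2 _] := rcons_endpoints _ _ _ uP jP; have [h3 h4] := IHq u uP.
have -> : take k (rcons u j) = take k u.
  by rewrite -cats1 takel_cat // uP.1 leq_addr.
by split; [apply: le_trans h3 h1|apply: le_trans h2 h4].
Qed.

(** Distinct intervals of one rank lie one to the left of the other, and both have length [L k].
    Words with different parents inherit the order of the parents. *)
Lemma words_separated k u v : word n k u -> word n k v -> u != v ->
  L k <= `|(I u).1 - (I v).1|.
Proof.
move=> uP vP uv.
suff [h|h] : (I u).2 <= (I v).1 \/ (I v).2 <= (I u).1.
- rewrite (word_endpoints _ _ uP) in h; rewrite distrC.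
  by rewrite (le_trans _ (ler_norm _)) //; lra.
- rewrite (word_endpoints _ _ vP) in h.
  by rewrite (le_trans _ (ler_norm _)) //; lra.
elim: k u v uP vP uv => [|k IHk] u v; first by move=> /word0 -> /word0 ->.
move=> /word_rcons[u' [i [-> uP iP]]] /word_rcons[v' [j [-> vP jP]]].
have [u1 u2 u3] := rcons_endpoints _ _ _ uP iP.
have [v1 v2 v3] := rcons_endpoints _ _ _ vP jP.
have [uv|uv _] := eqVneq u' v'; last first.
  by have [h|h] := IHk _ _ uP vP uv; [left|right]; lra.
move: uv vP v1 v2 v3 => <- _ v1 v2 v3; rewrite eqseq_rcons eqxx /= => ij.
have [_ triv _] := hI.2 k.+1 u' isT uP.
set A := I (rcons u' i) in u1 u2 u3 *; set B := I (rcons u' j) in v1 v2 v3 *.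
have [|AB] := leP A.2 B.1; first by left.
have [|BA] := leP B.2 A.1; first by right.
exfalso; move/eqP: ij; apply; apply: (triv i j iP jP).
(* If two siblings overlapped, the midpoint of the overlap would lie in both interiors. *)
pose z := (Num.max A.1 B.1 + Num.min A.2 B.2) / 2.
have Lk := rank_length_gt0 k.+1.
exists z; rewrite /itv_set !interior_itv_bnd /= !in_itv /= -/A -/B /z.
by split; case: (leP A.1 B.1); case: (leP A.2 B.2) => *; apply/andP; split; lra.
Qed.

(** Each level is a finite union of segments, hence closed, and level 0 is [J]. *)
Lemma moran_limit_set_compact : compact (moran_limit_set n I).
Proof.
apply: (@subclosed_compact _ _ `[J.1, J.2]).
- apply: closed_bigI => k _; apply: closed_bigcup; first exact: finite_word.
  by move=> w _; exact: interval_closed.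
- exact: segment_compact.
- move=> x /(_ 0%N Logic.I)[w /word0 ->].
  by rewrite /itv_set hI.1.
Qed.


(** * Gaps of the limit set inside short windows *)

Lemma prod_rank_length_le (theta : R) (k q : nat) :
  (forall i, (k < i)%N -> (n i)%:R * c i <= theta) ->
  (\prod_(k.+1 <= i < (k + q).+1) n i)%:R * L (k + q)%N <= L k * theta ^+ q.
Proof.
(* After division by [L k], each [n i] is paired with [c i], and each of the [q] pairs contributes a
   factor at most [theta]. *)
move=> nc; rewrite (rank_lengthD k q) mulrCA ler_pM2l ?rank_length_gt0 //.
elim: q => [|q IHq]; first by rewrite addn0 !big_geq // mulr1 expr0.
have kq : (k < (k + q).+1)%N by rewrite ltnS leq_addr.
rewrite addnS.
rewrite (big_nat_recr _ _ n kq) (big_nat_recr _ _ c kq) /=.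
rewrite natrM mulrACA exprSr.
apply: ler_pM => //; rewrite ?mulr_ge0 ?ler0n //; last exact: nc.
- rewrite big_nat prodr_ge0 // => i /andP[ki _].
  by rewrite ltW // c_gt0 // (leq_ltn_trans _ ki).
- by rewrite ltW // c_gt0.
Qed.

(* The points s + 5 i L (k + q) of the window all being close to E would need as
   many different words of rank k + q, more than the few words of rank k meeting
   the window have as descendants. *)
Lemma exists_gap (theta : R) (k q : nat) (r s : R) :
  (forall i, (k < i)%N -> (n i)%:R * c i <= theta) -> 50 * theta ^+ q <= 1 ->
  L k <= r ->
  exists2 y, s <= y <= s + r / 2 &
    forall z, moran_limit_set n I z -> L (k + q)%N < `|z - y|.
Proof.
move=> nc thq Lkr; have Lk0 := rank_length_gt0 k.
set m := (k + q)%N; have Lm0 := rank_length_gt0 m; set d := L m in Lm0 *.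
have dLk : d <= L k by apply: rank_length_le; exact: leq_addr.
have r0 : 0 < r by lra.
apply: contrapT => nogap.
pose y i := s + 5 * d * i%:R.
(* The largest index with [5 * d * M <= r / 2]: the points [y 0], ..., [y M] stay in the window,
   while [r < 10 * d * (M + 1)]. *)
pose M := Num.trunc (r / (10 * d)).
have /andP[] : M%:R <= r / (10 * d) < M.+1%:R.
  by apply: truncn_itv; rewrite divr_ge0 //; lra.
rewrite ler_pdivlMr ?ltr_pdivrMr; [|lra|lra] => M1 M2.
(* A point of the limit set within [d] of [y i] lies in an interval of length [d], whose left
   endpoint is then in [[y i - 2 * d, y i + d]]. These ranges have length [3 * d], less than the
   spacing [5 * d], so [f] is injective on the indices up to [M]. *)
have /choice[f fP] i : exists w, (i <= M)%N ->
    [/\ word n m w, y i - 2 * d <= (I w).1 & (I w).1 <= y i + d].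
  have [iM|_] := leqP i M; last by exists [::].
  have iR : (i%:R : R) <= M%:R by rewrite ler_nat.
  have i0 : (0 : R) <= i%:R by rewrite ler0n.
  have yi : s <= y i <= s + r / 2 by apply/andP; rewrite /y; split; nra.
  have /forallPNP/(_ (y i) yi)/existsNP[z /not_implyP[Ez /negP]] := nogap.
  rewrite -leNgt ler_norml => /andP[zy1 zy2].
  have [w wP] := Ez m Logic.I; rewrite /itv_set /= in_itv /=.
  rewrite (word_endpoints _ _ wP) -/d => /andP[z1 z2].
  by exists w => _; split => //; lra.
pose S := [seq f i | i <- iota 0 M.+1].
have SP w : w \in S -> exists2 i, (i <= M)%N & w = f i.
  by move=> /mapP[i]; rewrite mem_iota /= ltnS => iM ->; exists i.
pose P := undup [seq take k w | w <- S].
have uS : uniq S.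
  rewrite map_inj_in_uniq ?iota_uniq // => i j.
  rewrite !mem_iota /= add0n !ltnS => iM jM fij.
  have [_ i1 i2] := fP i iM; have [_ j1 j2] := fP j jM.
  rewrite fij in i1 i2; apply/eqP; rewrite eqn_leq.
  apply/andP; split; rewrite leqNgt; apply/negP => ij.
  + have : j%:R + 1 <= (i%:R : R) by rewrite natr1 ler_nat.
    by rewrite /y in i1 i2 j1 j2 => ?; nra.
  + have : i%:R + 1 <= (j%:R : R) by rewrite natr1 ler_nat.
    by rewrite /y in i1 i2 j1 j2 => ?; nra.
(* An ancestor contains its descendant, so its left endpoint is not to the right of the
   descendant's, and lies at most [L k - d] to the left of it. *)
have PP u : u \in P -> word n k u /\
    s - d - L k <= (I u).1 <= s - d - L k + (r / 2 + 2 * d + L k).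
  rewrite mem_undup => /mapP[_ /SP[i iM ->] ->].
  have [wP w1 w2] := fP i iM.
  have uP : word n k (take k (f i)) by apply: word_take wP; exact: leq_addr.
  split => //; have [t1 t2] := take_endpoints _ _ _ wP.
  rewrite (word_endpoints _ _ uP) (word_endpoints _ _ wP) -/d in t2.
  have iR : (i%:R : R) <= M%:R by rewrite ler_nat.
  have i0 : (0 : R) <= i%:R by rewrite ler0n.
  rewrite /y in w1 w2; apply/andP; split; nra.
have sizeP : (size P)%:R <= (r / 2 + 2 * d + L k) / L k + 1.
  apply: (@size_separated_le _ _ (fun u => (I u).1) _ (s - d - L k)) => //.
  - lra.
  - exact: undup_uniq.
  - move=> u v /PP[uP _] /PP[vP _]; exact: words_separated.
  - by move=> u /PP[].
have sizeS : (M.+1 <= size P * \prod_(k.+1 <= i < m.+1) n i)%N.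
  rewrite -{1}(size_iota 0 M.+1) -(size_map f); apply: size_words_le => //.
  - by move=> _ /SP[i iM ->]; have [] := fP i iM.
  - by move=> w wS; rewrite mem_undup; apply: map_f.
have := prod_rank_length_le theta k q nc; rewrite -/m -/d.
set N := (\prod_(_ <= _ < _) _)%N in sizeS *.
move: sizeS; rewrite -(ler_nat R) natrM => sizeS Nd.
have N0 : (0 : R) <= N%:R by rewrite ler0n.
(* As [d <= L k <= r], the sum [r / 2 + 2 * d + 2 * L k] is at most [9 / 2 * r]. The estimates below
   then give [r < 10 * (9 / 2) * r / 50], that is [r < 9 / 10 * r], a contradiction. *)
have sizeP' : (size P)%:R * L k <= 9 / 2 * r.
  rewrite -ler_pdivlMr //; apply: le_trans sizeP _.
  rewrite -[X in _ + X](divff (lt0r_neq0 Lk0)) -mulrDl ler_pM2r ?invr_gt0 //; lra.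
have h1 : r < 10 * ((size P)%:R * (N%:R * d)).
  apply: lt_le_trans M2 _; rewrite mulrCA ler_pM2l //.
  by rewrite mulrA ler_pM2r.
have h2 : (size P)%:R * (N%:R * d) <= (size P)%:R * L k * theta ^+ q.
  by rewrite -mulrA ler_wpM2l ?ler0n.
have h3 : (size P)%:R * L k * theta ^+ q <= 9 / 2 * r * (1 / 50).
  apply: le_trans (_ : (size P)%:R * L k * (1 / 50) <= _).
    by apply: ler_wpM2l; [rewrite mulr_ge0 ?ler0n // ltW | lra].
  by apply: ler_wpM2r => //; lra.
lra.
Qed.

(** * Consequences of the two asymptotic hypotheses *)

Lemma limn_esup_lt1_ratio :
  (limn_esup (fun k : nat => (ln (n k)%:R / - ln (c k))%:E) < 1%:E)%E ->
  exists theta : R, exists K : nat, 0 <= theta < 1 /\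
    forall i, (K < i)%N -> (n i)%:R * c i <= theta.
Proof.
move=> /ereal_inf_lt[_ [V [K _ KV] <-] Vlt].
have [a a1 aP] : exists2 a : R, a < 1 &
    forall i, (K < i)%N -> ln (n i)%:R / - ln (c i) <= a.
  have VK i : (K < i)%N -> ((ln (n i)%:R / - ln (c i))%:E <=
      ereal_sup [set (ln (n k)%:R / - ln (c k))%:E | k in V])%E.
    by move=> Ki; apply: ereal_sup_ubound; exists i => //; apply: KV; exact: ltnW.
  (* The supremum over the tail is a real number: it is below 1, and it dominates the real value at
     [K.+1]. *)
  move: Vlt VK; case: (ereal_sup _) => [a| |] //.
  - by rewrite lte_fin => a1 aP; exists a => // i /aP; rewrite lee_fin.
  - by move=> _ /(_ K.+1 (ltnSn K)); rewrite leeNy_eq.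
(* This is [2 ^ (a - 1)]: from [ln (n i) <= - a * ln (c i)] follows [n i * c i <= c i ^ (1 - a)],
   and [c i <= 1 / 2]. *)
exists (expR (- ((1 - a) * ln 2))), K; split.
  rewrite expR_ge0 expR_lt1 oppr_lt0 mulr_gt0 ?subr_gt0 // ln_gt0 //.
  by rewrite ltr1n.
move=> i Ki; have i0 : (0 < i)%N by apply: leq_ltn_trans Ki.
have ni0 : (0 : R) < (n i)%:R by rewrite ltr0n (leq_trans _ (hn i i0)).
have ci0 := c_gt0 i i0.
have lnc : ln (c i) <= - ln 2.
  by rewrite -lnV ?posrE // ler_ln ?posrE ?invr_gt0 // c_le_half.
have ln2 : (0 : R) < ln 2 by rewrite ln_gt0 // ltr1n.
have := aP i Ki; rewrite ler_pdivrMr; last by lra.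
move=> lnn; rewrite -[leLHS]lnK ?posrE ?mulr_gt0 // ler_expR lnM ?posrE //.
nra.
Qed.

Lemma rank_length_near0 (e : R) : 0 < e -> \forall k \near \oo, L k < e.
Proof.
move=> e0.
have Lle k : L k <= L 0%N * 2^-1 ^+ k.
  elim: k => [|k IHk]; first by rewrite expr0 mulr1.
  have := rank_lengthS_le k; rewrite exprSr mulrA => /le_trans; apply.
  by rewrite ler_pM2r ?invr_gt0.
have : (fun k => L 0%N * 2^-1 ^+ k) @ \oo --> (L 0%N * 0 : R).
  by apply: cvgMl_tmp; apply: cvg_expr;
    rewrite ger0_norm ?invr_ge0 // invf_lt1 // ltr1n.
rewrite mulr0 => /cvgrPdist_lt/(_ e e0); apply: filterS => k.
by rewrite sub0r normrN => /(le_lt_trans (ler_norm _)); exact: le_lt_trans.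
Qed.

Lemma exists_rank (r : R) : 0 < r ->
  exists k, L k <= r /\ forall m, L m <= r -> (k <= m)%N.
Proof.
move=> r0; have [k _ kP] := rank_length_near0 r r0.
have ex : exists k, L k <= r by exists k; apply/ltW/kP => /=.
by exists (ex_minn ex); case: ex_minnP => m Lm mP; split.
Qed.

(** With [p k] the product of the first [k] ratios, [ln (L k)] and [ln (p k)] differ by a constant
    while [ln (p k)] tends to minus infinity, so [L] may be replaced by [p]. For [p], the ratio over
    [q] ranks is a product of [q] one-rank ratios, each tending to 1. *)
Lemma ln_rank_length_ratio (q : nat) :
  (fun k : nat => ln (c k) / ln (\prod_(1 <= i < k.+1) c i)) @ \oo --> (0 : R) ->
  (fun k => ln (L (k + q)%N) / ln (L k)) @ \oo --> (1 : R).
Proof.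
move=> hlim.
pose p k := \prod_(1 <= i < k.+1) c i.
have p0 k : 0 < p k.
  by rewrite /p big_nat prodr_gt0 // => i /andP[i0 _]; exact: c_gt0.
have lnL k : ln (L k) = ln (J.2 - J.1) + ln (p k).
  by rewrite /L -/(p k) lnM ?posrE ?subr_gt0 ?p0.
have ln2 : (0 : R) < ln 2 by rewrite ln_gt0 // ltr1n.
have lnp k : ln (p k) <= - (k%:R * ln 2).
  elim: k => [|k IHk]; first by rewrite /p big_geq // ln1 mul0r oppr0.
  rewrite /p big_nat_recr //= -/(p k) lnM ?posrE ?c_gt0 //.
  have : ln (c k.+1) <= - ln 2.
    by rewrite -lnV ?posrE // ler_ln ?posrE ?invr_gt0 ?c_gt0 // c_le_half.
  by rewrite -natr1; lra.
have lnp_y : (fun k => - ln (p k)) @ \oo --> +oo.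
  apply/cvgryPge => A; exists (Num.trunc (A / ln 2)).+1 => // k /= Ak.
  have : A / ln 2 < k%:R.
    by apply: lt_le_trans (truncnS_gt _) _; rewrite ler_nat.
  by rewrite ltr_pdivrMr // => ?; have := lnp k; lra.
(* Since [p 0 = 1], the quotients by [ln (p k)] take a default value at [k = 0]; the cancellations
   below are made only where this logarithm is negative. *)
have lnp_lt0 : \forall k \near \oo, ln (p k) < 0.
  by move/cvgryPgt/(_ 0): lnp_y; apply: filterS => k; rewrite oppr_gt0.
have invlnp : (fun k => (ln (p k))^-1) @ \oo --> (0 : R).
  have -> : (fun k => (ln (p k))^-1) = (fun k => - (- ln (p k))^-1).
    by apply/funext => k; rewrite invrN opprK.
  rewrite -oppr0; apply: cvgN; apply/gtr0_cvgV0 => //.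
  by apply: filterS lnp_lt0 => k; rewrite oppr_gt0.
have Lp : (fun k => ln (L k) / ln (p k)) @ \oo --> (1 : R).
  have : (fun k => 1 + ln (J.2 - J.1) * (ln (p k))^-1) @ \oo
      --> (1 + ln (J.2 - J.1) * 0 : R).
    by apply: cvgD; [exact: cvg_cst | exact: cvgMl_tmp].
  rewrite mulr0 addr0; apply: cvg_trans; apply: near_eq_cvg.
  apply: filterS lnp_lt0 => k pk.
  by rewrite lnL mulrDl divff ?lt_eqF // addrC.
have pL : (fun k => ln (p k) / ln (L k)) @ \oo --> (1 : R).
  have -> : (fun k => ln (p k) / ln (L k)) = (fun k => (ln (L k) / ln (p k))^-1).
    by apply/funext => k; rewrite invf_div.
  by rewrite -[X in _ --> X]invr1; apply: cvgV => //; exact: oner_neq0.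
(* The limit hypothesis enters here, shifted by one: the inverse of this ratio is
   [1 - ln (c k.+1) / ln (p k.+1)]. *)
have pS : (fun k => ln (p k.+1) / ln (p k)) @ \oo --> (1 : R).
  have : (fun k => (1 - ln (c k.+1) / ln (p k.+1))^-1) @ \oo --> ((1 - 0)^-1 : R).
    apply: cvgV; first by rewrite subr0 oner_neq0.
    apply: cvgB; first exact: cvg_cst.
    by rewrite -cvg_shiftS in hlim.
  rewrite subr0 invr1; apply: cvg_trans; apply: near_eq_cvg.
  have [N _ NP] := lnp_lt0; exists N => // k /= Nk.
  have h := NP _ Nk; have h1 := NP _ (leqW Nk); rewrite /= in h h1.
  have E : ln (p k.+1) = ln (p k) + ln (c k.+1).
    by rewrite /p big_nat_recr //= -/(p k) lnM ?posrE ?c_gt0 ?p0.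
  have -> : 1 - ln (c k.+1) / ln (p k.+1) = ln (p k) / ln (p k.+1).
    by rewrite -[1](divff (ltr0_neq0 h1)) -mulrBl {1}E addrK.
  by rewrite invf_div.
have pq : (fun k => ln (p (k + q)%N) / ln (p k)) @ \oo --> (1 : R).
  elim: q => [|q IHq].
    have : (fun=> 1 : R) @ \oo --> (1 : R) by exact: cvg_cst.
    apply: cvg_trans; apply: near_eq_cvg.
    by apply: filterS lnp_lt0 => k pk; rewrite addn0 divff // lt_eqF.
  rewrite -(cvg_shiftn q) in pS.
  have /(_ _) := cvgM pS IHq; rewrite mulr1 => lim.
  apply: cvg_trans lim; apply: near_eq_cvg.
  have [N _ NP] := lnp_lt0; exists N => // k /= Nk.
  have h := NP _ (leq_trans Nk (leq_addr q k)); rewrite /= in h.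
  by rewrite /= addnS mulrA divfK // lt_eqF.
rewrite -(cvg_shiftn q) in Lp.
have /(_ _) Lpq := cvgM Lp pq; have /(_ _) := cvgM Lpq pL.
rewrite !mulr1 => lim; apply: cvg_trans lim; apply: near_eq_cvg.
have [N _ NP] := lnp_lt0; exists N => // k /= Nk.
have h := NP _ (leq_trans Nk (leq_addr q k)); rewrite /= in h.
have h0 := NP _ Nk; rewrite /= in h0.
by rewrite /= !mulrA !divfK // lt_eqF.
Qed.

End Moran.

(** * Quasi uniform disconnectedness of Moran sets *)

Theorem corollary1 (R : realType) (J : R * R) (n : nat -> nat) (c : nat -> R)
    (hJ : J.1 < J.2)
    (hn : forall k, (1 <= k)%N -> (2 <= n k)%N)
    (hc : forall k, (1 <= k)%N -> 0 < c k <= 1 / (n k)%:R)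
    (hlim : (fun k : nat => ln (c k) / ln (\prod_(1 <= i < k.+1) c i))
              @ \oo --> (0 : R))
    (hlimsup : (limn_esup
        (fun k : nat => (ln (n k)%:R / - ln (c k))%:E) < 1%:E)%E)
    (E : set R) (hE : moran_class J n c E) :
  quasi_uniformly_disconnected (E : set R^o).
Proof.
case: hE => I [hI ->{E}]; split; first exact: (@moran_limit_set_compact _ J n c).
set L := rank_length J c.
have L0 k : 0 < L k := @rank_length_gt0 _ J n c hJ hc k.
have Lle k m : (k <= m)%N -> L m <= L k := @rank_length_le _ J n c hJ hn hc k m.
have [theta [K [/andP[th0 th1] nc]]] := @limn_esup_lt1_ratio _ n c hn hc hlimsup.
(* The bound on [theta ^+ q] produces the gaps; [0 < q] gains a factor 2, whence
   [psi r <= r / 2]. *)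
have [q [q0 thq]] : exists q, (0 < q)%N /\ 50 * theta ^+ q <= 1.
  have := @cvg_expr _ theta; rewrite ger0_norm // => /(_ th1).
  move=> /cvgrPdist_lt/(_ 50^-1)[//|N _ NP]; exists N.+1; split => //.
  have := NP N.+1 (leqnSn N); rewrite /= sub0r normrN ger0_norm ?exprn_ge0 //.
  lra.
have /choice[rk rkP] r : exists k, 0 < r ->
    L k <= r /\ forall m, L m <= r -> (k <= m)%N.
  have [r0|_] := ltP 0 r; last by exists 0%N.
  by have [k kP] := @exists_rank _ J n c hJ hn hc r r0; exists k.
have psi_le r : 0 < r -> L (rk r + q)%N <= r / 2.
  move=> r0; have [Lr _] := rkP r r0.
  apply: le_trans (_ : L (rk r).+1 <= _).
    by apply: Lle; rewrite -addn1 leq_add2l.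
  by have := @rank_lengthS_le _ J n c hJ hn hc (rk r); rewrite -/L; lra.
have rk_gt N r : 0 < r -> r < L N -> (N < rk r)%N.
  move=> r0 rN; have [Lr _] := rkP r r0; rewrite ltnNge; apply/negP => /Lle; lra.
(* A radius below [L K] has [rk r > K], so the bound by [theta] holds at all ranks beyond [rk r]. *)
exists (fun r => L (rk r + q)%N), (L K); split => //.
- by move=> r r0; rewrite L0; have := psi_le r r0; lra.
- apply/cvgrPdist_lt => e e0.
  (* The shift is [q.+1] because [rk r = j.+1] with [L j.+1 <= r < L j]: [r] is compared with [L j],
     which is [q.+1] ranks above [psi r]. Once [L j < 1] all logarithms are negative, and
     [ln (psi r) / ln r] lies between 1 and [ln (psi r) / ln (L j)]. *)
  have /cvgrPdist_lt/(_ e e0)[N1 _ N1P] :=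
    @ln_rank_length_ratio _ J n c hJ hn hc q.+1 hlim.
  have [N2 _ N2P] := @rank_length_near0 _ J n c hJ hn hc 1 ltr01.
  near=> r.
  have r0 : 0 < r by near: r; exact: nbhs_right_gt.
  have rN : r < L (maxn N1 N2) by near: r; exact: nbhs_right_lt.
  have [Lr rmin] := rkP r r0; have := psi_le r r0; have := rk_gt _ _ r0 rN.
  case: (rk r) Lr rmin => // j Lr rmin; rewrite ltnS geq_max => /andP[N1j N2j] psir.
  have rj : r < L j.
    by rewrite ltNge; apply/negP => /rmin; rewrite ltnn.
  have := N1P j N1j; have Lj1 := N2P j N2j; rewrite /= -/L addnS -addSn in Lj1 *.
  set m := (j.+1 + q)%N in psir *.
  have lnr : ln r < 0 by apply: ln_lt0; rewrite r0 (lt_trans rj).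
  have lnj : ln (L j) < 0 by apply: ln_lt0; rewrite L0.
  have lnrj : ln r < ln (L j) by rewrite ltr_ln ?posrE.
  have lnm : ln (L m) <= ln r by rewrite ler_ln ?posrE //; lra.
  have lb : 1 <= ln (L m) / ln r by rewrite ler_ndivlMr // mul1r.
  have ub : ln (L m) / ln r <= ln (L m) / ln (L j).
    apply: ler_wnM2l; first by lra.
    by rewrite lef_nV2 ?negrE // ltW.
  rewrite !ltr_norml => /andP[h1 h2]; apply/andP; split; lra.
- move=> x r Ex /andP[r0 rK]; have [Lr _] := rkP r r0.
  have psir := psi_le r r0; have Kr := rk_gt _ _ r0 rK.
  have ncr i : (rk r < i)%N -> (n i)%:R * c i <= theta.
    by move=> ri; apply: nc; exact: ltn_trans ri.
  have gap s := @exists_gap _ J n c I hJ hn hc hI theta (rk r) q r s ncr thq Lr.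
  have [y /andP[y1 y2] yP] := gap (x + r / 2).
  have [z /andP[z1 z2] zP] := gap (x - r).
  rewrite -/L in yP zP; set d := L _ in psir yP zP *.
  (* The ball of radius [d <= r / 2] around [x] lies in [[z, y]], since [z <= x - r / 2] and
     [x + r / 2 <= y]. *)
  exists (moran_limit_set n I `&` [set t | z <= t <= y]); split.
  + by move=> t [].
  + move=> t [Et]; rewrite /cball /= mdist_real ler_norml => /andP[t1 t2].
    split => //=; apply/andP; split; lra.
  + move=> t [Et /= /andP[t1 t2]]; rewrite /cball /= mdist_real ler_norml.
    apply/andP; split; lra.
  + apply: le_ereal_inf_tmp => _ [a [Ea /= /andP[a1 a2]] [b [Eb nb] <-]].
    rewrite lee_fin mdist_real.
    (* One of the cut points [z], [y] separates [a] from [b], and [b] alone is already farther than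
       [d] from it. *)
    have : ~~ (z <= b <= y) by apply/negP => zby; apply: nb.
    rewrite negb_and -!ltNge => /orP[bz|yb].
    * have := zP b Eb; rewrite ltr0_norm; last lra.
      move=> ?; rewrite (le_trans _ (ler_norm _)) //; lra.
    * have := yP b Eb; rewrite gtr0_norm; last lra.
      move=> ?; rewrite distrC (le_trans _ (ler_norm _)) //; lra.
Unshelve. all: by end_near.
Qed.
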